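(* (Model selection using sieves.) Let $\alpha\in(0,1)$ and let $\mathcal P_1\subset\mathcal P_2\subset\cdots$ be a nested sequence of models, each a set of probability densities with respect to a common measure. Suppose $Y_1,\dots,Y_{2n}$ are i.i.d. with density $p^*$, where $p^*\in\mathcal P_j$ for some (unknown) $j$, and split the data into two groups $D_0,D_1$ of size $n$. For $j=1,2,\dots$ in turn, reject $H_j:p^*\in\mathcal P_j$ if $$\prod_{i\in D_0}\frac{\widehat p_{j+1}(Y_i)}{\widehat p_j(Y_i)}>\frac1\alpha,$$ where $\widehat p_{j+1}$ in the numerator is the maximum likelihood estimator in $\mathcal P_{j+1}$ computed from $D_1$ and $\widehat p_j$ in the denominator is the maximum likelihood estimator in $\mathcal P_j$ computed from $D_0$. Let $\widehat j$ be the first $j$ such that $H_j$ is not rejected. Then $$P_{p^*}\big(p^*\in\mathcal P_{\widehat j-1}\big)\le\alpha .$$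
   Context: Conventions: $\mathcal P_0=\emptyset$; if no $H_j$ is left unrejected, $\widehat j=\infty$ and $\mathcal P_{\infty-1}=\bigcup_j\mathcal P_j$. The split into $D_0,D_1$ is a partition of the data indices chosen independently of the data. The maximum likelihood estimators are assumed to exist and all quantities are assumed measurable as needed. *)

(* Defs.v *)
From HB Require Import structures.
From mathcomp Require Import all_boot all_order all_algebra.
From mathcomp Require Import all_classical all_reals all_analysis.

Set Implicit Arguments.
Unset Strict Implicit.
Unset Printing Implicit Defensive.

Import Order.TTheory GRing.Theory Num.Theory.
Import numFieldNormedType.Exports.

Local Open Scope classical_set_scope.
Local Open Scope ring_scope.

Definition is_density d (T : measurableType d) (R : realType)
    (mu : {measure set T -> \bar R}) (p : T -> R) : Prop :=
  [/\ measurable_fun [set: T] p, forall y, 0 <= p y &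
      (\int[mu]_y (p y)%:E = 1)%E].

Definition has_density d d' (Omega : measurableType d) (T : measurableType d')
    (R : realType) (P : probability Omega R) (X : {RV P >-> T})
    (mu : {measure set T -> \bar R}) (p : T -> R) : Prop :=
  forall A, measurable A ->
    distribution P X A = (\int[mu]_(y in A) (p y)%:E)%E.

Definition mutually_independent d d' (Omega : measurableType d)
    (T : measurableType d') (R : realType) (P : probability Omega R)
    (I : finType) (X : I -> {RV P >-> T}) : Prop :=
  forall (J : {set I}) (A : I -> set T),
    (forall i, i \in J -> measurable (A i)) ->
    P (\bigcap_(i in [set` J]) (X i @^-1` A i)) =
    (\prod_(i in J) P (X i @^-1` A i))%E.

Definition full_sample d d' (Omega : measurableType d) (T : measurableType d')
    (R : realType) (P : probability Omega R) (m : nat)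
    (Y : 'I_m -> {RV P >-> T}) (w : Omega) : m.-tuple T :=
  [tuple Y i w | i < m].

(* [D w] is the set of indices put in the group D_0; the group D_1 is its
   complement. The split may be random. *)
Definition split_independent d d' (Omega : measurableType d)
    (T : measurableType d') (R : realType) (P : probability Omega R) (m : nat)
    (Y : 'I_m -> {RV P >-> T}) (D : Omega -> {set 'I_m}) : Prop :=
  (forall S, measurable (D @^-1` [set S])) /\
  forall (S : set {set 'I_m}) (B : set (m.-tuple T)), measurable B ->
    P (D @^-1` S `&` full_sample Y @^-1` B) =
    (P (D @^-1` S) * P (full_sample Y @^-1` B))%E.

(* The observations with index in [S], listed by increasing index. *)
Definition subsample (T : Type) (m : nat) (y : 'I_m -> T) (S : {set 'I_m}) :
    seq T :=
  [seq y i | i <- enum S].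

(* An estimator maps a finite sample to a function on the observation space;
   this is joint measurability, in the sample and the point of evaluation,
   for samples of size [n]. *)
Definition measurable_estimator d (T : measurableType d) (R : realType)
    (n : nat) (phat : seq T -> T -> R) : Prop :=
  measurable_fun [set: (n.-tuple T * T)%type]
    (fun z : n.-tuple T * T => phat (tval z.1) z.2).

Definition is_MLE (T : Type) (R : realType) (M : set (T -> R)) (s : seq T)
    (p : T -> R) : Prop :=
  M p /\ forall q, M q -> \prod_(y <- s) q y <= \prod_(y <- s) p y.

(* The numerator is fitted on D_1 = ~: D0, the denominator on D0. The quotient
   is taken in \bar R, where x / 0 = +oo for 0 < x and 0 / 0 = 0. *)
Definition split_LR (T : Type) (R : realType) (m : nat)
    (num den : seq T -> T -> R) (D0 : {set 'I_m}) (y : 'I_m -> T) : \bar R :=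
  (\prod_(i in D0) ((num (subsample y (~: D0)) (y i))%:E /
                    (den (subsample y D0) (y i))%:E))%E.

(* [None] stands for the value oo, when every H_j with j >= 1 is rejected. *)
Definition first_accepted (rejected : nat -> bool) : option nat :=
  if pselect (exists j, (0 < j)%N && ~~ rejected j) is left e
  then Some (ex_minn e) else None.

(* The model of index j - 1, with oo - 1 standing for the union of all models. *)
Definition preceding_model (T : Type) (M : nat -> set T) (j : option nat) :
    set T :=
  if j is Some k then M k.-1 else \bigcup_k M k.

(* Main.v *)
Require Import Defs.
From HB Require Import structures.
From mathcomp Require Import all_boot all_order all_algebra.
From mathcomp Require Import all_classical all_reals all_analysis.
From mathcomp Require Import measurable_realfun.

(** If j0 is the least index with p* in M j0, then p* lies in the model preceding
    the selected one only if the true hypothesis H_j0 is rejected, so it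
    suffices to bound the level of the test of H_j0. On almost every sample the
    denominator is at least the likelihood of p* on D_0, so the statistic is at
    most prod_(i in D_0) phat1 (Y_i) / p* (Y_i), where phat1 is a density that
    depends on D_1 only. Integrating out the observations in D_0 one at a time
    shows that this product has expectation at most 1, and Markov's inequality
    gives the level alpha. The base measure need not be sigma-finite, so Fubini
    is applied to the law of the observations only. *)

Set Implicit Arguments.
Unset Strict Implicit.
Unset Printing Implicit Defensive.

Import Order.TTheory GRing.Theory Num.Theory.
Import numFieldNormedType.Exports.
Import HBNNSimple.

Local Open Scope classical_set_scope.
Local Open Scope ring_scope.

(** * Integrals against a density; uniqueness of finite measures on tuples *)

(** True for indicators by assumption, for simple functions by linearity, and then for [f] by
    monotone convergence along simple approximations; [mu] may be any measure. *)
Lemma integral_density (R : realType) (d : measure_display)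
    (T : measurableType d) (mu nu : {measure set T -> \bar R}) (p : T -> R)
    (f : T -> \bar R) :
  measurable_fun [set: T] p -> (forall y, 0 <= p y) ->
  (forall A, measurable A -> nu A = (\int[mu]_(y in A) (p y)%:E)%E) ->
  measurable_fun [set: T] f -> (forall y, (0 <= f y)%E) ->
  (\int[nu]_y f y = \int[mu]_y (f y * (p y)%:E))%E.
Proof.
move=> mp p0 nuE mf f0.
have mpE : measurable_fun [set: T] (EFin \o p) by exact/measurable_EFinP.
have p0E y : (0 <= (EFin \o p) y)%E by rewrite lee_fin.
have indicE_density (A : set T) : measurable A ->
    (\int[nu]_y (\1_A y)%:E = \int[mu]_y ((\1_A y)%:E * (p y)%:E))%E.
  move=> mA; rewrite integral_indic// setIT nuE// integral_mkcond.
  apply: eq_integral => y _; rewrite patchE indicE.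
  by case: ifPn => _; rewrite ?mul1e ?mul0e.
pose g := nnsfun_approx measurableT mf.
have nnsfun_density n :
    (\int[nu]_y (g n y)%:E = \int[mu]_y ((g n y)%:E * (p y)%:E))%E.
  under [LHS]eq_integral do rewrite fimfunE -fsumEFin//.
  rewrite [LHS]ge0_integral_fsum//; last 2 first.
    - by move=> r; exact/measurable_EFinP/measurableT_comp.
    - by move=> r y _; rewrite EFinM nnfun_muleindic_ge0.
  under [RHS]eq_integral.
    move=> y _; rewrite fimfunE -fsumEFin// ge0_mule_fsuml; last first.
      by move=> r; rewrite EFinM nnfun_muleindic_ge0.
    over.
  rewrite [RHS]ge0_integral_fsum//; last 2 first.
    - move=> r; apply: emeasurable_funM => //.
      by apply/measurable_EFinP; exact: measurableT_comp.
    - move=> r y _; apply: mule_ge0; last by rewrite lee_fin.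
      by rewrite EFinM nnfun_muleindic_ge0.
  apply: eq_fsbigr => r rg.
  have r0 : (0 <= r)%R by move: rg; rewrite inE => -[y _ <-].
  rewrite (integralZl_indic_nnsfun nu measurableT) indicE_density//.
  under [RHS]eq_integral do rewrite EFinM -muleA.
  rewrite ge0_integralZl//.
  - by apply: emeasurable_funM => //; exact/measurable_EFinP.
  - by move=> y _; rewrite mule_ge0// lee_fin.
have g_cvg y : (g n y)%:E @[n --> \oo] --> f y.
  exact: cvg_nnsfun_approx.
transitivity (limn (fun n => (\int[nu]_y (g n y)%:E)%E)).
  rewrite -monotone_convergence//.
  - by apply: eq_integral => y _; apply/esym/cvg_lim.
  - by move=> n; exact/measurable_EFinP.
  - by move=> n y _; rewrite lee_fin.
  - by move=> y _ m n mn; rewrite lee_fin; exact/lefP/nd_nnsfun_approx.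
under eq_fun do rewrite nnsfun_density.
rewrite -monotone_convergence//.
- apply: eq_integral => y _; apply/cvg_lim => //.
  by under eq_fun do rewrite muleC; rewrite muleC; apply: cvgeZl.
- by move=> n; apply: emeasurable_funM => //; exact/measurable_EFinP.
- by move=> n y _; rewrite mule_ge0// lee_fin.
- move=> y _ m n mn; apply: lee_wpmul2r; rewrite lee_fin//.
  exact/lefP/nd_nnsfun_approx.
Qed.

(** Rectangles are stable under intersection and generate the product sigma-algebra; finite total
    mass lets the whole space serve as the exhausting sequence. *)
Lemma finite_measure_tuple_unique (R : realType) (d : measure_display)
    (T : measurableType d) (m : nat)
    (m1 m2 : {measure set (m.-tuple T) -> \bar R}) :
  (m1 setT < +oo)%E ->
  (forall A : 'I_m -> set T, (forall i, measurable (A i)) ->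
    m1 [set t | forall i, A i (tnth t i)] =
    m2 [set t | forall i, A i (tnth t i)]) ->
  forall B, measurable B -> m1 B = m2 B.
Proof.
move=> m1fin m12 B mB.
pose G := [set B : set (m.-tuple T) | exists A : 'I_m -> set T,
  (forall i, measurable (A i)) /\ B = [set t | forall i, A i (tnth t i)]].
have GT : G setT.
  by exists (fun=> setT); split=> //; apply/seteqP; split.
apply: (measure_unique G (fun=> setT)) => //.
- apply/seteqP; split.
  + apply: smallest_sub; first exact: smallest_sigma_algebra.
    move=> C; rewrite -bigcup_seq => -[i _ [A mA <-{C}]].
    apply: sub_sigma_algebra.
    (* A cylinder over one coordinate is a rectangle whose other sides are full, so the rectangles
       generate. *)
    exists (fun j => if j == i then A else setT); split.
      by move=> j; case: ifP.
    rewrite setTI; apply/seteqP; split=> t /=.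
      by move=> At j; case: eqVneq => [->|].
    by move=> /(_ i); rewrite eqxx.
  + apply: smallest_sub; first exact: sigma_algebra_measurable.
    move=> C [A [mA ->]].
    rewrite [X in measurable X](_ : _ =
        \bigcap_(i in [set: 'I_m]) ((fun t => tnth t i) @^-1` A i)).
      apply: fin_bigcap_measurable => // i _.
      by rewrite -[X in measurable X]setTI; exact: measurable_tnth.
    by apply/seteqP; split=> [t At i _|t At i]; [exact: At|exact: (At i I)].
- move=> _ _ [A [mA ->]] [A' [mA' ->]].
  exists (fun i => A i `&` A' i); split; first by move=> i; exact: measurableI.
  apply/seteqP; split=> t /=; first by move=> [At A't] i; split.
  by move=> At; split=> i; have [] := At i.
- by apply/seteqP; split=> // t _; exists 0%N.
- by move=> _ [A [mA ->]]; exact: m12.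
Qed.

(** * Measurability of the sample and of its resampling at one coordinate *)

Lemma measurable_full_sample d d' (Omega : measurableType d)
    (T : measurableType d') (R : realType) (P : probability Omega R) (m : nat)
    (Y : 'I_m -> {RV P >-> T}) :
  measurable_fun [set: Omega] (full_sample Y).
Proof.
apply/measurable_fun_tnthP => i.
rewrite (_ : _ \o _ = Y i) //; apply/funext => w /=.
by rewrite tnth_mktuple.
Qed.

Definition tset (T : Type) (m : nat) (b : 'I_m) (t : m.-tuple T) (y : T) :
    m.-tuple T :=
  [tuple if i == b then y else tnth t i | i < m].

Lemma measurable_tset (d : measure_display) (T : measurableType d) (m : nat)
    (b : 'I_m) :
  measurable_fun [set: m.-tuple T * T] (fun z => tset b z.1 z.2).
Proof.
apply/measurable_fun_tnthP => i.
rewrite (_ : _ \o _ = fun z => if i == b then z.2 else tnth z.1 i); last first.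
  by apply/funext => z /=; rewrite tnth_mktuple.
case: (i == b); first exact: measurable_snd.
exact: (measurableT_comp (measurable_tnth i)).
Qed.

(** Under the product of [P] with the law of [Y b], this is the sample with its entry at [b]
    replaced by an independent copy. *)
Definition resample d d' (Omega : measurableType d) (T : measurableType d')
    (R : realType) (P : probability Omega R) (m : nat)
    (Y : 'I_m -> {RV P >-> T}) (b : 'I_m) (z : Omega * T) : m.-tuple T :=
  tset b (full_sample Y z.1) z.2.

Lemma measurable_resample d d' (Omega : measurableType d)
    (T : measurableType d') (R : realType) (P : probability Omega R) (m : nat)
    (Y : 'I_m -> {RV P >-> T}) (b : 'I_m) :
  measurable_fun [set: Omega * T] (resample Y b).
Proof.
apply: (@measurableT_comp _ _ _ _ _ _ (fun z => tset b z.1 z.2) _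
  (fun z => (full_sample Y z.1, z.2))).
  exact: measurable_tset.
apply: measurable_fun_pair => //.
exact: (measurableT_comp (measurable_full_sample Y)).
Qed.

Lemma emeasurable_prod (R : realType) (d : measure_display)
    (T : measurableType d) (I : Type) (s : seq I) (f : I -> T -> \bar R) :
  (forall i, measurable_fun [set: T] (f i)) ->
  measurable_fun [set: T] (fun t => (\prod_(i <- s) f i t)%E).
Proof.
move=> mf; elim: s => [|i s ih].
  by under eq_fun do rewrite big_nil; exact: measurable_cst.
by under eq_fun do rewrite big_cons; exact: emeasurable_funM.
Qed.

(** * Exchanging observations for independent copies *)

Section resampling.
Context (R : realType) (d d' : measure_display) (Omega : measurableType d)
  (T : measurableType d') (P : probability Omega R) (m : nat)
  (Y : 'I_m -> {RV P >-> T}).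
Hypothesis Y_indep : mutually_independent Y.

(** Both probabilities factor into the same marginals, the side [A b] being measured by the extra
    coordinate on the right. Independence of the observations is used only through this identity. *)
Lemma mutually_independent_resample (b : 'I_m) (A : 'I_m -> set T) :
  (forall i, measurable (A i)) ->
  P (full_sample Y @^-1` [set t | forall i, A i (tnth t i)]) =
  (P \x distribution P (Y b))%E
    (resample Y b @^-1` [set t | forall i, A i (tnth t i)]).
Proof.
move=> mA.
have mYA i : measurable (Y i @^-1` A i).
  by rewrite -[X in measurable X]setTI; exact: measurable_funPT.
have -> : full_sample Y @^-1` [set t | forall i, A i (tnth t i)] =
    \bigcap_(i in [set` [set: 'I_m]%SET]) (Y i @^-1` A i).
  apply/seteqP; split=> w /= Aw i; last by rewrite tnth_mktuple; apply: Aw; rewrite /= inE.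
  by move=> _; have := Aw i; rewrite tnth_mktuple.
have -> : resample Y b @^-1` [set t | forall i, A i (tnth t i)] =
    (\bigcap_(i in [set` [set~ b]%SET]) (Y i @^-1` A i)) `*` A b.
  apply/seteqP; split=> -[w y] /=.
    move=> Aw; split=> [i|] /=.
      by rewrite !inE => /negbTE ib; have := Aw i; rewrite !tnth_mktuple ib.
    by have := Aw b; rewrite tnth_mktuple eqxx.
  move=> [Aw Ay] i; rewrite tnth_mktuple; case: eqVneq => [-> //|ib].
  by rewrite tnth_mktuple; apply: Aw; rewrite /= !inE.
have YE (J : {set 'I_m}) : P (\bigcap_(i in [set` J]) (Y i @^-1` A i)) =
    (\prod_(i in J) P (Y i @^-1` A i))%E by exact: Y_indep.
rewrite product_measure1E//; last first.
  by apply: fin_bigcap_measurable => //; exact: finite_set_finType.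
rewrite !YE (bigD1 b) ?inE// [RHS]muleC; congr (_ * _)%E.
apply: etrans (esym (YE _)).
by apply: eq_bigl => i; rewrite !inE.
Qed.

(** The original and the resampled data agree on rectangles, hence in law; Tonelli then separates
    the new coordinate. *)
Lemma ge0_integral_resample (b : 'I_m) (F : m.-tuple T -> \bar R) :
  measurable_fun [set: m.-tuple T] F -> (forall t, (0 <= F t)%E) ->
  (\int[P]_w F (full_sample Y w) =
   \int[P]_w \int[distribution P (Y b)]_y F (tset b (full_sample Y w) y))%E.
Proof.
move=> mF F0.
have mY := measurable_full_sample Y.
have mYb := measurable_resample Y b.
transitivity (\int[pushforward P (full_sample Y)]_t F t)%E.
  by rewrite ge0_integral_pushforward.
transitivity (\int[pushforward (P \x distribution P (Y b)) (resample Y b)]_t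
    F t)%E.
  apply: eq_measure_integral => B mB _.
  apply: finite_measure_tuple_unique => //.
    by rewrite /= /pushforward preimage_setT probability_setT ltry.
  exact: mutually_independent_resample.
rewrite ge0_integral_pushforward// preimage_setT fubini_tonelli1//.
- exact: measurableT_comp.
- by move=> z; exact: F0.
Qed.

(* Integrating out one coordinate of [s] after the other leaves a product with
   one factor less, because no factor depends on the coordinates in [s]. *)
Lemma integral_prod_resample_le1 (s : seq 'I_m)
    (k : 'I_m -> m.-tuple T * T -> \bar R) : uniq s ->
  (forall i, measurable_fun [set: m.-tuple T * T] (k i)) ->
  (forall i z, (0 <= k i z)%E) ->
  (forall i b t x y, b \in s -> k i (tset b t y, x) = k i (t, x)) ->
  (forall i t, (\int[distribution P (Y i)]_x k i (t, x) <= 1)%E) ->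
  (\int[P]_w \prod_(i <- s) k i (full_sample Y w, Y i w) <= 1)%E.
Proof.
move=> + mk k0 + k1; elim: s => [_ _|b s ih /= /andP[bs us] ks].
  under eq_integral do rewrite big_nil.
  by rewrite integral_cst//= mul1e probability_setT.
apply: le_trans (ih us _); last first.
  by move=> i c t x y cs; apply: ks; rewrite inE cs orbT.
have mki i : measurable_fun [set: m.-tuple T] (fun t => k i (t, tnth t i)).
  apply: (measurableT_comp (mk i)); apply: measurable_fun_pair => //.
  exact: measurable_tnth.
have mY := measurable_full_sample Y.
pose F t := (\prod_(i <- b :: s) k i (t, tnth t i))%E.
pose F' t := (\prod_(i <- s) k i (t, tnth t i))%E.
have mF : measurable_fun setT F by exact: emeasurable_prod.
have mF' : measurable_fun setT F' by exact: emeasurable_prod.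
have F0 t : (0 <= F t)%E by apply: prode_ge0.
have F'0 t : (0 <= F' t)%E by apply: prode_ge0.
have -> : (\int[P]_w \prod_(i <- b :: s) k i (full_sample Y w, Y i w) =
    \int[P]_w F (full_sample Y w))%E.
  by apply: eq_integral => w _; apply: eq_bigr => i _; rewrite tnth_mktuple.
have -> : (\int[P]_w \prod_(i <- s) k i (full_sample Y w, Y i w) =
    \int[P]_w F' (full_sample Y w))%E.
  by apply: eq_integral => w _; apply: eq_bigr => i _; rewrite tnth_mktuple.
rewrite (ge0_integral_resample b)//.
(* As [b] does not recur in [s], the new value [y] is a point of evaluation only for the factor at
   [b]; all first arguments can be reset to [t]. *)
have FE t y : F (tset b t y) = (F' t * k b (t, y))%E.
  rewrite /F big_cons tnth_mktuple eqxx ks ?mem_head// muleC; congr (_ * _)%E.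
  apply: eq_big_seq => i si; rewrite ks ?mem_head// tnth_mktuple.
  by case: eqVneq => // ib; move: bs; rewrite -ib si.
apply: ge0_le_integral => //.
- by move=> w _; apply: integral_ge0 => y _; exact: F0.
- apply: (measurable_fun_fubini_tonelli_F
    (fun z => F (resample Y b z))) => //.
  by apply: measurableT_comp => //; exact: measurable_resample.
- exact: measurableT_comp.
move=> w _; under eq_integral do rewrite FE.
rewrite ge0_integralZl//.
- by rewrite -[leRHS]mule1; apply: lee_wpmul2l => //; exact: k1.
- exact: (measurable_fun_pair2 _ (mk b)).
Qed.

End resampling.

(** * Measurability of the fitted functions and of the split statistic *)

(** Fixing the size turns the list into a [k]-tuple, the type on which [measurable_estimator] is
    stated. *)
Lemma measurable_subsample (d : measure_display) (T : measurableType d)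
    (m k : nat) (S : {set 'I_m}) : #|S| = k ->
  exists c : m.-tuple T -> k.-tuple T,
    measurable_fun [set: m.-tuple T] c /\
    forall t, tval (c t) = subsample (tnth t) S.
Proof.
move=> <-; exists (fun t => map_tuple (tnth t) (enum_tuple S)).
split=> //; apply/measurable_fun_tnthP => i.
rewrite (_ : _ \o _ = fun t => tnth t (tnth (enum_tuple S) i)); last first.
  by apply/funext => t /=; rewrite tnth_map.
exact: measurable_tnth.
Qed.

Lemma measurable_estimator_subsample (R : realType) (d : measure_display)
    (T : measurableType d) (m k : nat) (S : {set 'I_m})
    (phat : seq T -> T -> R) : #|S| = k -> measurable_estimator k phat ->
  measurable_fun [set: m.-tuple T * T]
    (fun z => phat (subsample (tnth z.1) S) z.2).
Proof.
move=> /(measurable_subsample T)[c [mc cE]] mphat.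
under eq_fun do rewrite -cE.
apply: (measurableT_comp mphat (g := fun z => (c z.1, z.2))).
apply: measurable_fun_pair => //.
exact: (measurableT_comp mc).
Qed.

Lemma measurable_invr (R : realType) :
  measurable_fun [set: R] (fun r => r^-1).
Proof.
have -> : [set: R] = [set 0] `|` ~` [set 0] by rewrite setUv.
apply/measurable_funU => //; first exact: measurableC.
split; first exact: measurable_fun_set1.
apply: open_continuous_measurable_fun.
  by apply: closed_openC; exact: closed_eq.
move=> r; rewrite inE /= => /eqP r0.
exact: inv_continuous.
Qed.

Lemma measurable_inver (R : realType) :
  measurable_fun [set: R] (fun r => ((r%:E)^-1)%E).
Proof.
under eq_fun do rewrite inver.
apply: measurable_fun_ifT => //; first exact: measurable_fun_eqr.
by apply/measurable_EFinP; exact: measurable_invr.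
Qed.

Lemma measurable_split_LR (R : realType) (d : measure_display)
    (T : measurableType d) (m n0 n1 : nat) (S : {set 'I_m})
    (num den : seq T -> T -> R) : #|S| = n0 -> #|~: S| = n1 ->
  measurable_estimator n0 den -> measurable_estimator n1 num ->
  measurable_fun [set: m.-tuple T] (fun t => split_LR num den S (tnth t)).
Proof.
move=> S0 S1 mden mnum.
rewrite /split_LR; under eq_fun do rewrite -big_enum.
apply: emeasurable_prod => i.
have mi : measurable_fun [set: m.-tuple T] (fun t => (t, tnth t i)).
  by apply: measurable_fun_pair => //; exact: measurable_tnth.
apply: emeasurable_funM.
  apply/measurable_EFinP.
  exact: (measurableT_comp (measurable_estimator_subsample S1 mnum) mi).
apply: (measurableT_comp (@measurable_inver R)).
exact: (measurableT_comp (measurable_estimator_subsample S0 mden) mi).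
Qed.

(** * Comparing the statistic with the likelihood ratio against the true density *)

(** The law of [X] gives the zero set of [p] the integral of [p] over it, which is 0. *)
Lemma density_positive_ae (R : realType) (d d' : measure_display)
    (Omega : measurableType d) (T : measurableType d') (P : probability Omega R)
    (mu : {measure set T -> \bar R}) (X : {RV P >-> T}) (p : T -> R) :
  is_density mu p -> has_density X mu p -> \forall w \ae P, 0 < p (X w).
Proof.
move=> [mp p0 _] Xp.
have mp0 : measurable (p @^-1` [set 0]) by rewrite -[X in measurable X]setTI; exact: mp.
exists (X @^-1` (p @^-1` [set 0])); split.
- by rewrite -[X in measurable X]setTI; exact: measurable_funPT.
- rewrite -[LHS]/(distribution P X _) Xp//.
  by apply: integral0_eq => y /= ->.
- by move=> w /=; rewrite lt_neqAle p0 andbT => /negP; rewrite negbK => /eqP.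
Qed.

(** Multiplying the ratio by [p] gives [q] where [p] is positive and 0 elsewhere; the mass of [q] on
    the zero set of [p] is lost, hence an inequality. The truncation at 0 matches [ratio] below. *)
Lemma integral_density_ratio_le1 (R : realType) (d : measure_display)
    (T : measurableType d) (mu nu : {measure set T -> \bar R}) (p q : T -> R) :
  is_density mu p -> is_density mu q ->
  (forall A, measurable A -> nu A = (\int[mu]_(y in A) (p y)%:E)%E) ->
  (\int[nu]_y (Num.max 0 (q y) / p y)%:E <= 1)%E.
Proof.
move=> [mp p0 _] [mq q0 intq] nuE.
have mr : measurable_fun [set: T] (fun y => (Num.max 0 (q y) / p y)%:E).
  apply/measurable_EFinP; apply: measurable_funM.
    exact: measurable_maxr.
  exact: (measurableT_comp (@measurable_invr R)).
have r0 y : (0 <= (Num.max 0 (q y) / p y)%:E)%E.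
  by rewrite lee_fin divr_ge0// le_max lexx.
rewrite (integral_density mp p0 nuE mr r0) -intq.
apply: ge0_le_integral => //.
- by move=> y _; rewrite mule_ge0// lee_fin.
- by apply: emeasurable_funM => //; exact/measurable_EFinP.
- exact/measurable_EFinP.
- move=> y _; rewrite -EFinM lee_fin max_r//.
  by have [->|py] := eqVneq (p y) 0; [rewrite mulr0|rewrite divfK].
Qed.

(** The purpose of splitting the data: the fit on D_1 does not see D_0, whose observations can be
    resampled while the numerator stays fixed. *)
Lemma subsample_tset (T : Type) (m : nat) (S : {set 'I_m}) (b : 'I_m)
    (t : m.-tuple T) (y : T) :
  b \in S -> subsample (tnth (tset b t y)) (~: S) = subsample (tnth t) (~: S).
Proof.
move=> bS; apply/eq_in_map => i; rewrite mem_enum inE tnth_mktuple => iS.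
by case: eqVneq => // ib; move: iS; rewrite ib bS.
Qed.

Lemma subsample_full_sample d d' (Omega : measurableType d)
    (T : measurableType d') (R : realType) (P : probability Omega R) (m : nat)
    (Y : 'I_m -> {RV P >-> T}) (w : Omega) (S : {set 'I_m}) :
  subsample (tnth (full_sample Y w)) S = subsample (fun i => Y i w) S.
Proof. by apply: eq_map => i; rewrite tnth_mktuple. Qed.

Lemma split_LR_le (T : Type) (R : realType) (m : nat)
    (num den : seq T -> T -> R) (S : {set 'I_m}) (y : 'I_m -> T) (p : T -> R) :
  (forall i, 0 < p (y i)) ->
  (forall x, 0 <= num (subsample y (~: S)) x) ->
  (forall x, 0 <= den (subsample y S) x) ->
  \prod_(i in S) p (y i) <= \prod_(i in S) den (subsample y S) (y i) ->
  (split_LR num den S y <=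
   \prod_(i in S) (num (subsample y (~: S)) (y i) / p (y i))%:E)%E.
Proof.
set q := num _; set r := den _ => p0 q0 r0 pr.
have prod_p0 : 0 < \prod_(i in S) p (y i) by apply: prodr_gt0.
have prod_r0 := lt_le_trans prod_p0 pr.
(* A vanishing factor would make the likelihood of [den] zero, below the positive one of [p]. Hence
   [split_LR] never divides by 0 here and the comparison takes place in [R]. *)
have rn0 i : i \in S -> r (y i) != 0.
  move=> iS; apply/eqP => ri0; move: prod_r0.
  by rewrite (bigD1 i)//= ri0 mul0r ltxx.
have -> : split_LR num den S y = (\prod_(i in S) (q (y i) / r (y i))%:E)%E.
  by apply: eq_bigr => i iS; rewrite inver (negbTE (rn0 i iS)).
rewrite !prodEFin lee_fin !big_split/= !prodfV.
by rewrite ler_wpM2l ?prodr_ge0// lef_pV2.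
Qed.

(** * Level of a single split likelihood ratio test *)

Section split_test.
Context (R : realType) (d d' : measure_display) (Omega : measurableType d)
  (T : measurableType d') (P : probability Omega R)
  (mu : {measure set T -> \bar R}) (pstar : T -> R) (m n0 n1 : nat)
  (Y : 'I_m -> {RV P >-> T}) (num den : seq T -> T -> R).
Hypothesis pstar_density : is_density mu pstar.
Hypothesis Y_indep : mutually_independent Y.
Hypothesis Y_density : forall i, has_density (Y i) mu pstar.
Hypothesis num_meas : measurable_estimator n1 num.
Hypothesis den_meas : measurable_estimator n0 den.

Section fixed_split.
Variable S : {set 'I_m}.
Hypothesis S1 : #|~: S| = n1.

(** The maximum with 0 is inactive when the fit is a density; it makes the ratio nonnegative at
    every sample, as Tonelli requires. *)
Let ratio (z : m.-tuple T * T) : R :=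
  Num.max 0 (num (subsample (tnth z.1) (~: S)) z.2) / pstar z.2.

(** The mean of the ratio at a fresh copy of [Y i] with the fit held fixed: for [i] in D_0, its
    conditional expectation given D_1. *)
Let mass i (t : m.-tuple T) : \bar R :=
  (\int[distribution P (Y i)]_x (ratio (t, x))%:E)%E.

(* Truncating at the samples where the numerator fails to be a density makes the
   conditional expectation at most one everywhere, not just almost surely. *)
Let factor i (z : m.-tuple T * T) : \bar R :=
  if (mass i z.1 <= 1)%E then (ratio z)%:E else 0%E.

Let ratio_ge0 z : (0 <= (ratio z)%:E)%E.
Proof.
case: pstar_density => _ p0 _.
by rewrite lee_fin divr_ge0// le_max lexx.
Qed.

Let measurable_ratio : measurable_fun [set: m.-tuple T * T] (EFin \o ratio).
Proof.
case: pstar_density => mp _ _.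
apply/measurable_EFinP; apply: measurable_funM.
  by apply: measurable_maxr => //; exact: measurable_estimator_subsample num_meas.
apply: (measurableT_comp (@measurable_invr R)).
exact: measurableT_comp.
Qed.

Let factor_ge0 i z : (0 <= factor i z)%E.
Proof. by rewrite /factor; case: ifP. Qed.

Let measurable_mass i : measurable_fun [set: m.-tuple T] (mass i).
Proof. exact: (measurable_fun_fubini_tonelli_F (EFin \o ratio)). Qed.

Let measurable_factor i : measurable_fun [set: m.-tuple T * T] (factor i).
Proof.
apply: measurable_fun_ifT => //; apply: measurable_fun_lee => //.
exact: (measurableT_comp (measurable_mass i)).
Qed.

Let integral_factor i t :
  (\int[distribution P (Y i)]_x factor i (t, x) <= 1)%E.
Proof.
rewrite /factor /=; have [//|_] := leP (mass i t) 1%E.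
by rewrite integral0.
Qed.

Let region alpha := [set t : m.-tuple T |
  ((alpha^-1)%:E < \prod_(i in S) factor i (t, tnth t i))%E].

Let measurable_region alpha : measurable (region alpha).
Proof.
rewrite -[region alpha]setTI; apply: measurable_lte => //.
under eq_fun do rewrite -big_enum.
apply: emeasurable_prod => i; apply: (measurableT_comp (measurable_factor i)).
by apply: measurable_fun_pair => //; exact: measurable_tnth.
Qed.

Let prob_region alpha : 0 < alpha ->
  (P (full_sample Y @^-1` region alpha) <= alpha%:E)%E.
Proof.
move=> alpha0.
pose F w := (\prod_(i in S) factor i (full_sample Y w, Y i w))%E.
have F0 w : (0 <= F w)%E by apply: prode_ge0.
have mF : measurable_fun [set: Omega] F.
  rewrite /F; under eq_fun do rewrite -big_enum.
  apply: emeasurable_prod => i; apply: (measurableT_comp (measurable_factor i)).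
  by apply: measurable_fun_pair => //; exact: measurable_full_sample.
have intF : (\int[P]_w F w <= 1)%E.
  rewrite /F; under eq_integral do rewrite -big_enum.
  apply: integral_prod_resample_le1 => //; first exact: enum_uniq.
  (* Overwriting an entry in [S] leaves the fit on D_1 unchanged, hence also the ratio, its mass and
     the truncation. *)
  move=> i b t x y; rewrite mem_enum => bS.
  have ratioE x' : ratio (tset b t y, x') = ratio (t, x').
    by rewrite /ratio /= subsample_tset.
  rewrite /factor ratioE /= (_ : mass i (tset b t y) = mass i t)//.
  by apply: eq_integral => x' _; rewrite ratioE.
have := le_integral_abse P measurableT mF (a := alpha^-1).
rewrite invr_gt0 => /(_ alpha0).
rewrite setTI => markov.
have mYR : measurable (full_sample Y @^-1` region alpha).
  rewrite -[X in measurable X]setTI.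
  exact: (measurable_full_sample Y).
have mark1 : ((alpha^-1)%:E * P (full_sample Y @^-1` region alpha) <= 1)%E.
  apply: le_trans intF.
  under [leRHS]eq_integral do rewrite -[F _]gee0_abs//.
  apply: le_trans markov; apply: lee_wpmul2l.
    by rewrite lee_fin invr_ge0 ltW.
  apply: le_measure; rewrite ?inE//.
    by rewrite -[X in measurable X]setTI; apply: measurable_lee => //;
      exact: measurableT_comp.
  move=> w /ltW wR; rewrite /= gee0_abs//; apply: le_trans wR _.
  rewrite le_eqVlt; apply/predU1P; left.
  by apply: eq_bigr => i _; rewrite tnth_mktuple.
rewrite -(@lee_pmul2l _ (alpha^-1)%:E) ?lte_fin ?invr_gt0//.
by rewrite -EFinM mulVf ?gt_eqF.
Qed.

(** The properties of the estimators for the split [S] will be known only at those [w] whose split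
    is [S], so the rejection event for a fixed [S] cannot be bounded over all of [Omega]. The set
    [B] depends on the sample alone, has small probability whatever the split, and captures
    rejection at every good [w]. *)
Lemma split_LR_region alpha : 0 < alpha ->
  exists B : set (m.-tuple T), [/\ measurable B,
    (P (full_sample Y @^-1` B) <= alpha%:E)%E &
    forall w, (forall i, 0 < pstar (Y i w)) ->
      is_density mu (num (subsample (fun i => Y i w) (~: S))) ->
      (forall x, 0 <= den (subsample (fun i => Y i w) S) x) ->
      \prod_(i in S) pstar (Y i w) <=
        \prod_(i in S) den (subsample (fun i => Y i w) S) (Y i w) ->
      ((alpha^-1)%:E < split_LR num den S (fun i => Y i w))%E ->
      B (full_sample Y w)].
Proof.
move=> alpha0; exists (region alpha); split => //.
  exact: prob_region.
move=> w pw qdens r0 pr aLR.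
have [_ q0 _] := qdens.
rewrite /region /=; apply: lt_le_trans aLR _.
apply: le_trans (split_LR_le pw q0 r0 pr) _.
(* The fit is a density at this sample, so the truncation in [factor] is inactive. *)
have mass_le1 i : (mass i (full_sample Y w) <= 1)%E.
  rewrite /mass /ratio /= subsample_full_sample.
  exact: integral_density_ratio_le1 (Y_density i).
rewrite le_eqVlt; apply/predU1P; left; apply: eq_bigr => i _.
rewrite /factor /= mass_le1 /ratio /= subsample_full_sample tnth_mktuple.
by rewrite max_r.
Qed.

End fixed_split.

Section random_split.
Variable D : Omega -> {set 'I_m}.
Hypotheses (D0 : forall w, #|D w| = n0) (D1 : forall w, #|~: D w| = n1).
Hypothesis D_indep : split_independent Y D.

Let rejection alpha : set Omega :=
  [set w | ((alpha^-1)%:E < split_LR num den (D w) (fun i => Y i w))%E].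

Let rejectionE alpha :
  rejection alpha = \bigcup_(S in [set: {set 'I_m}])
    (rejection alpha `&` D @^-1` [set S]).
Proof.
apply/seteqP; split=> [w rw|w [S _ [rw _]]//].
by exists (D w).
Qed.

Let measurable_rejection_split alpha (S : {set 'I_m}) :
  measurable (rejection alpha `&` D @^-1` [set S]).
Proof.
(* A value never taken by [D] may have the wrong size, but its event is empty. *)
have [[w0 Dw0]|noS] := pselect (exists w, D w = S); last first.
  rewrite (_ : _ `&` _ = set0)//; apply/seteqP; split=> // w [_ DwS].
  by apply: noS; exists w.
have S0 : #|S| = n0 by rewrite -Dw0.
have S1 : #|~: S| = n1 by rewrite -Dw0.
have -> : rejection alpha `&` D @^-1` [set S] =
    full_sample Y @^-1` [set t | ((alpha^-1)%:E < split_LR num den S (tnth t))%E]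
    `&` D @^-1` [set S].
  have tnthY w : tnth (full_sample Y w) = (fun i => Y i w).
    by apply/funext => i; rewrite tnth_mktuple.
  by apply/seteqP; split=> w [rw Dw]; split=> //; move: rw;
    rewrite /rejection /= tnthY Dw.
apply: measurableI; last exact: D_indep.1.
rewrite -[X in measurable X]setTI; apply: (measurable_full_sample Y) => //.
rewrite -[X in measurable X]setTI; apply: measurable_lte => //.
exact: measurable_split_LR S0 S1 den_meas num_meas.
Qed.

Lemma measurable_split_LR_rejection alpha :
  measurable [set w |
    ((alpha^-1)%:E < split_LR num den (D w) (fun i => Y i w))%E].
Proof.
rewrite -/(rejection alpha) rejectionE.
by apply: fin_bigcup_measurable => //; exact: finite_finset.
Qed.

(** Decompose over the finitely many values [S] of [D]. Up to a null set, rejection with split [S]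
    lies in the event that [D] is [S] and the sample is in [B], which by independence has
    probability at most [alpha] times that of [S]; these bounds sum to [alpha]. *)
Lemma split_LR_test_level alpha : 0 < alpha ->
  (\forall w \ae P, is_density mu (num (subsample (fun i => Y i w) (~: D w)))) ->
  (\forall w \ae P,
    (forall x, 0 <= den (subsample (fun i => Y i w) (D w)) x) /\
    \prod_(i in D w) pstar (Y i w) <=
      \prod_(i in D w) den (subsample (fun i => Y i w) (D w)) (Y i w)) ->
  (P [set w | (alpha^-1)%:E < split_LR num den (D w) (fun i => Y i w)] <=
   alpha%:E)%E.
Proof.
move=> alpha0 numD denD; rewrite -/(rejection alpha).
have pY : \forall w \ae P, forall i, 0 < pstar (Y i w).
  by apply: filter_forall => i; exact: density_positive_ae (Y_density i).
have [N [mN PN0 goodN]] := filterI pY (filterI numD denD).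
have trivD : trivIset [set: {set 'I_m}] (fun S => D @^-1` [set S]).
  by move=> S S' _ _ [w [/= -> ->]].
have bound_split S : (P (rejection alpha `&` D @^-1` [set S]) <=
    alpha%:E * P (D @^-1` [set S]))%E.
  have [[w0 Dw0]|noS] := pselect (exists w, D w = S); last first.
    rewrite (_ : rejection alpha `&` _ = set0).
      by rewrite measure0; apply: mule_ge0 => //; rewrite lee_fin ltW.
    apply/seteqP; split=> // w [_ DwS].
    by apply: noS; exists w.
  have S1 : #|~: S| = n1 by rewrite -Dw0.
  have [B [mB PB rejB]] := split_LR_region S1 alpha0.
  have mDB : measurable (D @^-1` [set S] `&` full_sample Y @^-1` B).
    apply: measurableI; first exact: D_indep.1.
    by rewrite -[X in measurable X]setTI; exact: (measurable_full_sample Y).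
  apply: (@le_trans _ _ (P ((D @^-1` [set S] `&` full_sample Y @^-1` B) `|` N))).
    apply: le_measure; rewrite ?inE//; first exact: measurableU.
    move=> w [rw DwS]; have [Nw|nNw] := pselect (N w); [by right|left].
    split=> //.
    have [pw [qw [r0 pr]]] : (forall i, 0 < pstar (Y i w)) /\
        is_density mu (num (subsample (fun i => Y i w) (~: D w))) /\
        (forall x, 0 <= den (subsample (fun i => Y i w) (D w)) x) /\
        \prod_(i in D w) pstar (Y i w) <=
          \prod_(i in D w) den (subsample (fun i => Y i w) (D w)) (Y i w).
      by apply: contrapT => bad; apply: nNw; exact: goodN.
    rewrite /rejection /= in rw DwS; rewrite DwS in qw r0 pr rw.
    exact: rejB.
  apply: le_trans (measureU2 _ mDB mN) _.
  rewrite [X in (_ + X)%E]PN0 adde0 [leLHS]D_indep.2// muleC.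
  by rewrite lee_wpmul2r.
rewrite rejectionE measure_fin_bigcup//.
- apply: (@le_trans _ _
      (\sum_(S \in [set: {set 'I_m}]) alpha%:E * P (D @^-1` [set S]))%E).
    by apply: lee_fsum => [|S _]; [exact: finite_finset|exact: bound_split].
  rewrite -ge0_mule_fsumr// -measure_fin_bigcup//.
  + have -> : \bigcup_(S in [set: {set 'I_m}]) D @^-1` [set S] = setT.
      by apply/seteqP; split=> // w _; exists (D w).
    by rewrite [X in (_ * X)%E]probability_setT mule1.
  + exact: finite_finset.
  + by move=> S _; exact: D_indep.1.
- exact: finite_finset.
- by move=> S S' _ _ [w [[_ /= ->] [_ /= ->]]].
Qed.

End random_split.

End split_test.

(** * From the selected index to the test of the least correct model *)

(** By nestedness [M j] contains [p] exactly when [j0 <= j], so the model before the first accepted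
    [k] contains [p] exactly when [j0 < k], that is, when no index from 1 to [j0] is accepted. For
    [None] both sides hold. *)
Lemma preceding_model_first_accepted (T : Type) (M : nat -> set T)
    (rejected : nat -> bool) (p : T) (j0 : nat) :
  (forall j, M j `<=` M j.+1) -> M j0 p -> (forall j, M j p -> (j0 <= j)%N) ->
  preceding_model M (first_accepted rejected) p <->
  (forall j, (0 < j <= j0)%N -> rejected j).
Proof.
move=> nestedM Mj0 j0_min.
have mono j : (j0 <= j)%N -> M j p.
  elim: j => [|j ih]; first by rewrite leqn0 => /eqP <-.
  by rewrite leq_eqVlt => /predU1P[<- //|/ih]; exact: nestedM.
rewrite /first_accepted; case: pselect => [ex|noacc] /=; last first.
  split=> [_ j /andP[j_gt0 _]|_]; last by exists j0.
  by apply: contrapT => /negP rj; apply: noacc; exists j; rewrite j_gt0.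
case: ex_minnP => k /andP[k_gt0 rk] k_min; split=> [/j0_min j0k j /andP[j_gt0 jj0]|rej].
  apply: contrapT => /negP rj; have /k_min : (0 < j)%N && ~~ rejected j by rewrite j_gt0.
  by rewrite leqNgt (leq_ltn_trans jj0)// -(prednK k_gt0).
(* As [k] is positive, [j0 <= k.-1] means [j0 < k]; otherwise [k] would be both accepted and
   rejected. *)
apply: mono; rewrite -ltnS prednK// ltnNge.
by apply: contra rk => kj0; apply: rej; rewrite k_gt0.
Qed.

Unset Implicit Arguments.

Theorem mainTheorem5 (R : realType) (d d' : measure_display)
    (Omega : measurableType d) (T : measurableType d')
    (P : probability Omega R) (mu : {measure set T -> \bar R})
    (alpha : R) (halpha0 : 0 < alpha) (halpha1 : alpha < 1)
    (M : nat -> set (T -> R))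
    (hM0 : M 0%N = set0)
    (hMdensity : forall j p, M j p -> is_density mu p)
    (hMnested : forall j, M j `<=` M j.+1)
    (pstar : T -> R) (hpstar : exists j, M j pstar)
    (n : nat) (Y : 'I_(2 * n) -> {RV P >-> T})
    (hYindep : mutually_independent Y)
    (hYdensity : forall i, has_density (Y i) mu pstar)
    (D : Omega -> {set 'I_(2 * n)})
    (hDsize : forall w, #|D w| = n)
    (hDindep : split_independent Y D)
    (phat0 phat1 : nat -> seq T -> T -> R)
    (hphat0_meas : forall j, (0 < j)%N -> measurable_estimator n (phat0 j))
    (hphat1_meas : forall j, (0 < j)%N -> measurable_estimator n (phat1 j.+1))
    (hphat0 : forall j, (0 < j)%N -> \forall w \ae P,
       let s := subsample (fun i => Y i w) (D w) in
       is_MLE (M j) s (phat0 j s))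
    (hphat1 : forall j, (0 < j)%N -> \forall w \ae P,
       let s := subsample (fun i => Y i w) (~: D w) in
       is_MLE (M j.+1) s (phat1 j.+1 s)) :
  let rejected (w : Omega) (j : nat) : bool :=
    ((alpha^-1)%:E <
       split_LR (phat1 j.+1) (phat0 j) (D w) (fun i => Y i w))%E in
  let jhat (w : Omega) : option nat := first_accepted (rejected w) in
  (P [set w | preceding_model M (jhat w) pstar] <= alpha%:E)%E.
Proof.
pose rejected (w : Omega) (j : nat) : bool :=
  ((alpha^-1)%:E <
     split_LR (phat1 j.+1) (phat0 j) (D w) (fun i => Y i w))%E.
pose jhat w := first_accepted (rejected w).
change (is_true (P [set w | preceding_model M (jhat w) pstar] <= alpha%:E)%E).
have exj0 : exists j, `[< M j pstar >] by case: hpstar => j Mj; exists j; apply/asboolP.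
case: (ex_minnP exj0) => j0 /asboolP Mj0 j0_min.
have j0_least j : M j pstar -> (j0 <= j)%N by move=> Mj; apply/j0_min/asboolP.
(* [M 0] is empty, so [j0] is at least 1 and its hypothesis is among those tested. *)
have j0_gt0 : (0 < j0)%N.
  by rewrite lt0n; apply/eqP => j00; move: Mj0; rewrite j00 hM0.
have pstar_density := hMdensity _ _ Mj0.
have hDsizeC w : #|~: D w| = n.
  by rewrite cardsCs finset.setCK card_ord hDsize mul2n -addnn addnK.
have mrej j : (0 < j)%N -> measurable [set w | rejected w j].
  move=> j_gt0; apply: measurable_split_LR_rejection => //.
  - exact: hphat1_meas.
  - exact: hphat0_meas.
(* Writing the event as a finite intersection also yields its measurability, which monotonicity of
   [P] asks for. *)
have -> : [set w | preceding_model M (jhat w) pstar] =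
    \bigcap_(j in [set j | (0 < j <= j0)%N]) [set w | rejected w j].
  apply/seteqP; split=> w /=.
    by move=> /(preceding_model_first_accepted _ hMnested Mj0 j0_least).
  by move=> rej; apply/(preceding_model_first_accepted _ hMnested Mj0 j0_least).
apply: (@le_trans _ _ (P [set w | rejected w j0])).
  apply: le_measure; rewrite ?inE.
  - apply: fin_bigcap_measurable => [|j /andP[j_gt0 _]]; last exact: mrej.
    by apply: (sub_finite_set _ (finite_II j0.+1)) => j /= /andP[].
  - exact: mrej.
  - by move=> w; apply; rewrite /= j0_gt0 leqnn.
apply: (split_LR_test_level pstar_density hYindep hYdensity) => //.
- exact: hphat1_meas.
- exact: hphat0_meas.
- apply: filterS (hphat1 _ j0_gt0) => w /= [M1 _].
  exact: hMdensity M1.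
(* [pstar] lies in [M j0], so it is a competitor of the maximum likelihood fit on D_0. *)
- apply: filterS (hphat0 _ j0_gt0) => w /= [M0 /(_ _ Mj0)].
  rewrite !big_map !big_enum => MLE; split=> //.
  by have [] := hMdensity _ _ M0.
Qed.
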